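(* Let $I$ be an ideal of a Noetherian local ring $(R,\mathfrak{m})$ and let $\cdots\to F_2\xrightarrow{d_2}F_1\xrightarrow{d_1}F_0\to R/I\to0$ be a minimal free resolution of $R/I$ (with $F_0=R$). Set $s_n=\mathrm{AR}(\mathfrak{m},\operatorname{im}(d_{n+1})\subseteq F_n)$ for all $n\ge0$, and let $p$ and $N_0$ be natural numbers with $N_0>\max\{s_i: i=0,\ldots,p\}$. Let $N>N_0+\sum_{i=0}^{p-1}s_i$. Then for every ideal $J$ of $R$ such that $J+\mathfrak{m}^N=I+\mathfrak{m}^N$ and such that $R/I$ and $R/J$ have the same Hilbert function, there exist $R$-linear maps $\delta_i:F_i\to\mathfrak{m}^{N_0}F_{i-1}$, $i=1,\ldots,p+1$, such that $F_{p+1}\xrightarrow{d_{p+1}+\delta_{p+1}}F_p\xrightarrow{d_p+\delta_p}\cdots\xrightarrow{d_2+\delta_2}F_1\xrightarrow{d_1+\delta_1}F_0\to R/J\to0$ is exact; moreover, $(\operatorname{im} d_i)^*=(\operatorname{im}(d_i+\delta_i))^*$ for all $i=1,\ldots,p+1$, where both initial modules are computed inside $\mathrm{gr}_{\mathfrak{m}}(F_{i-1})$.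
   Context: $\mathrm{AR}(\mathfrak{m},L\subseteq M)$ is the least integer $s$ with $\mathfrak{m}^nM\cap L=\mathfrak{m}^{n-s}(\mathfrak{m}^sM\cap L)$ for all $n\ge s$. For a submodule $L$ of a finitely generated module $M$, the initial module $L^*\subseteq\mathrm{gr}_{\mathfrak{m}}(M)=\bigoplus_i\mathfrak{m}^iM/\mathfrak{m}^{i+1}M$ is $\bigoplus_{i\ge0}(L\cap\mathfrak{m}^iM+\mathfrak{m}^{i+1}M)/\mathfrak{m}^{i+1}M$. The Hilbert function of $R/I$ is $n\mapsto\dim_k\mathfrak{m}^n(R/I)/\mathfrak{m}^{n+1}(R/I)$, $k=R/\mathfrak{m}$. *)

(* Defs.v *)
From HB Require Import structures.
From mathcomp Require Import all_boot all_order all_algebra.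
Set Implicit Arguments. Unset Strict Implicit. Unset Printing Implicit Defensive.
Import GRing.Theory.
Local Open Scope ring_scope.

Section CommAlg.
Variable R : comNzRingType.

Definition seteq (T : Type) (A B : T -> Prop) := forall x, A x <-> B x.

Definition is_ideal (I : R -> Prop) :=
  [/\ I 0, (forall x y, I x -> I y -> I (x + y)) & (forall a x, I x -> I (a * x))].

Definition proper_ideal (I : R -> Prop) := is_ideal I /\ ~ I 1.

Definition is_local_ring (m : R -> Prop) :=
  proper_ideal m /\ forall I, proper_ideal I -> forall x, I x -> m x.

Definition ideal_gen n (g : 'I_n -> R) : R -> Prop :=
  fun x => exists c : 'I_n -> R, x = \sum_i c i * g i.

Definition noetherian :=
  forall I, is_ideal I -> exists n (g : 'I_n -> R), seteq I (ideal_gen g).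

Definition ideal_add (I J : R -> Prop) : R -> Prop :=
  fun x => exists a c, [/\ I a, J c & x = a + c].

Definition ideal_mul (I J : R -> Prop) : R -> Prop :=
  fun x => exists n (a c : 'I_n -> R),
    [/\ forall i, I (a i), forall i, J (c i) & x = \sum_i a i * c i].

Definition ideal_pow (I : R -> Prop) (k : nat) : R -> Prop :=
  iter k (ideal_mul I) (fun _ => True).

Definition smul (I : R -> Prop) n (K : 'rV[R]_n -> Prop) : 'rV[R]_n -> Prop :=
  fun v => exists k (a : 'I_k -> R) (w : 'I_k -> 'rV[R]_n),
    [/\ forall i, I (a i), forall i, K (w i) & v = \sum_i a i *: w i].

Definition mpowF (m : R -> Prop) k n : 'rV[R]_n -> Prop :=
  smul (ideal_pow m k) (fun _ : 'rV[R]_n => True).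
Arguments mpowF m k n _ : clear implicits.

Definition mx_im a b (A : 'M[R]_(a, b)) : 'rV[R]_b -> Prop :=
  fun v => exists u : 'rV[R]_a, v = u *m A.
Definition mx_ker a b (A : 'M[R]_(a, b)) : 'rV[R]_a -> Prop :=
  fun u => u *m A = 0.

Definition AR_holds (m : R -> Prop) n (L : 'rV[R]_n -> Prop) (s : nat) :=
  forall k, (s <= k)%N ->
    seteq (fun v => mpowF m k n v /\ L v)
          (smul (ideal_pow m (k - s)) (fun v => mpowF m s n v /\ L v)).

Definition is_AR (m : R -> Prop) n (L : 'rV[R]_n -> Prop) (s : nat) :=
  AR_holds m L s /\ forall s', AR_holds m L s' -> (s <= s')%N.

(* Degree-i component of the initial module L^* ⊆ gr_m(F), represented by its
   preimage L ∩ m^i F + m^(i+1) F in m^i F. *)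
Definition initial_comp (m : R -> Prop) n (L : 'rV[R]_n -> Prop) (i : nat)
  : 'rV[R]_n -> Prop :=
  fun v => exists x y, [/\ L x, mpowF m i n x, mpowF m i.+1 n y & v = x + y].

Definition same_initial (m : R -> Prop) n (L L' : 'rV[R]_n -> Prop) :=
  forall i, seteq (initial_comp m L i) (initial_comp m L' i).

(* The k-vector space m^k(R/I)/m^(k+1)(R/I) = (m^k + I)/(m^(k+1) + I), k = R/m,
   has dimension >= r: there are r elements whose classes are k-linearly
   independent. *)
Definition hilb_ge (m I : R -> Prop) (k r : nat) :=
  exists x : 'I_r -> R,
    (forall i, ideal_add (ideal_pow m k) I (x i)) /\
    (forall c : 'I_r -> R,
        ideal_add (ideal_pow m k.+1) I (\sum_i c i * x i) -> forall i, m (c i)).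

Definition same_hilbert (m I J : R -> Prop) :=
  forall k r, hilb_ge m I k r <-> hilb_ge m J k r.

(* ... -> F_2 --d 1--> F_1 --d 0--> F_0 = R -> R/I -> 0 is a minimal free
   resolution, with F_n = R^(b n) and d n representing d_(n+1). *)
Definition min_free_res (m I : R -> Prop) (b : nat -> nat)
    (d : forall n, 'M[R]_(b n.+1, b n)) :=
  [/\ b 0%N = 1%N,
      (forall v : 'rV[R]_(b 0%N), mx_im (d 0%N) v <-> forall j, I (v 0 j)),
      (forall n, seteq (mx_ker (d n)) (mx_im (d n.+1)))
    & (forall n i j, m (d n i j))].

End CommAlg.
Arguments mpowF {R} m k n _.

(* Main.v *)
(* The resolution is perturbed one map at a time, keeping
   im(d_i)^* = im(d_i + delta_i)^* and delta_i = 0 mod m^(M_i), where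
   M_i = N - (s_0 + ... + s_(i-2)) > s_(i-1).  The initial module of a
   submodule with Artin-Rees number s is generated in degrees <= s, so it can
   only grow under a perturbation modulo m^M with M > s; in degree zero the
   equality of Hilbert functions forces I^* = J^*.  Equality of initial modules
   transfers the Artin-Rees number from im d to im(d + delta).  Hence for u in
   ker d the element (d + delta)(u) = delta(u) lies in m^(M-s) im(d + delta), and
   correcting u puts it in ker(d + delta) modulo m^(M-s); by symmetry the two
   kernels have the same initial module.  Correcting the generators of ker d in
   this way yields the next map, and its image is all of ker(d + delta) by
   Krull's intersection theorem since both have the same initial module. *)

Require Import Defs.
From HB Require Import structures.
From mathcomp Require Import all_boot all_order all_algebra.
From Stdlib Require Import Classical IndefiniteDescription.
Import GRing.Theory.
Local Open Scope ring_scope.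

Section Development.
Set Implicit Arguments.
Unset Strict Implicit.
Variable R : comNzRingType.
Implicit Types m I J : R -> Prop.

(** * Ideals, their products and powers *)

Definition is_submod n (K : 'rV[R]_n -> Prop) :=
  [/\ K 0, forall v w, K v -> K w -> K (v + w) & forall x v, K v -> K (x *: v)].

Lemma ideal_sum I r (f : 'I_r -> R) :
  is_ideal I -> (forall i, I (f i)) -> I (\sum_i f i).
Proof. by move=> [I0 ID _] If; elim/big_ind: _ => // i _; apply: If. Qed.

Lemma idealB I x y : is_ideal I -> I x -> I y -> I (x - y).
Proof. by move=> [_ ID IM] Ix Iy; apply: ID => //; rewrite -mulN1r; apply: IM. Qed.

Lemma ideal_mul_min I J K :
  is_ideal K -> (forall x y, I x -> J y -> K (x * y)) ->
  forall z, ideal_mul I J z -> K z.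
Proof.
by move=> Kid IJK z [r [u [w [Iu Jw ->]]]]; apply: ideal_sum => // i; apply: IJK.
Qed.

Lemma mem_ideal_mul I J x y : I x -> J y -> ideal_mul I J (x * y).
Proof.
by move=> Ix Jy; exists 1%N, (fun=> x), (fun=> y); split=> //; rewrite big_ord1.
Qed.

Lemma ideal_mul_ideal I J : is_ideal I -> is_ideal (ideal_mul I J).
Proof.
move=> [I0 ID IM]; split.
- by exists 0%N, (fun=> 0), (fun=> 0); split; rewrite ?big_ord0 //; case.
- move=> x y [r1 [u1 [w1 [Iu1 Jw1 ->]]]] [r2 [u2 [w2 [Iu2 Jw2 ->]]]].
  exists (r1 + r2)%N, (fun i => match split i with inl j => u1 j | inr j => u2 j end),
    (fun i => match split i with inl j => w1 j | inr j => w2 j end).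
  split=> [i|i|]; try by case: (split i).
  rewrite big_split_ord /=; congr (_ + _); apply: eq_bigr => i _.
    by rewrite -[lshift _ _]/(unsplit (inl i)) unsplitK.
  by rewrite -[rshift _ _]/(unsplit (inr i)) unsplitK.
- move=> x y [r [u [w [Iu Jw ->]]]]; exists r, (fun i => x * u i), w.
  by split=> // [i|]; [apply: IM | rewrite mulr_sumr; apply: eq_bigr => i _; rewrite mulrA].
Qed.

Lemma ideal_pow_ideal I k : is_ideal I -> is_ideal (ideal_pow I k).
Proof. by move=> Iid; case: k => [|k]; [split | apply: ideal_mul_ideal]. Qed.

Lemma ideal_powD I j k x y :
  is_ideal I -> ideal_pow I j x -> ideal_pow I k y -> ideal_pow I (j + k) (x * y).
Proof.
move=> Iid; elim: j x => [|j IHj] x; first by move=> _; case: (ideal_pow_ideal k Iid) => _ _; apply.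
move=> Ix Iy; move: x Ix; apply: (ideal_mul_min (K := fun x => ideal_pow I (j.+1 + k) (x * y))).
  case: (ideal_pow_ideal (j.+1 + k) Iid) => P0 PD PM; split.
  - by rewrite mul0r.
  - by move=> u w; rewrite mulrDl; apply: PD.
  - by move=> u w; rewrite -mulrA; apply: PM.
by move=> u w Iu Iw; rewrite -mulrA; apply: mem_ideal_mul => //; apply: IHj.
Qed.

Lemma ideal_pow_le I j k x : is_ideal I -> (j <= k)%N -> ideal_pow I k x -> ideal_pow I j x.
Proof.
move=> Iid /subnK <-; elim: (k - j)%N x => // i IHi x.
apply: ideal_mul_min => [|u w _ /IHi]; first exact: ideal_pow_ideal.
by case: (ideal_pow_ideal j Iid) => _ _; apply.
Qed.

Lemma ideal_pow_mono I J k x :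
  (forall x, I x -> J x) -> ideal_pow I k x -> ideal_pow J k x.
Proof.
move=> IJ; elim: k x => // k IHk x [r [u [w [Iu Iw ->]]]].
by exists r, u, w; split=> [i|i|//]; [apply: IJ (Iu i) | apply: IHk (Iw i)].
Qed.

Lemma ideal_gen_ideal r (g : 'I_r -> R) : is_ideal (ideal_gen g).
Proof.
split.
- by exists (fun=> 0); rewrite big1 // => i _; rewrite mul0r.
- move=> x y [u ->] [w ->]; exists (fun i => u i + w i); rewrite -big_split.
  by apply: eq_bigr => i _; rewrite mulrDl.
- move=> x y [u ->]; exists (fun i => x * u i); rewrite mulr_sumr.
  by apply: eq_bigr => i _; rewrite mulrA.
Qed.

Lemma mem_ideal_gen r (g : 'I_r -> R) i : ideal_gen g (g i).
Proof.
exists (fun j => (i == j)%:R); rewrite (bigD1 i) //= eqxx mul1r big1 ?addr0 // => j.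
by rewrite eq_sym => /negPf ->; rewrite mul0r.
Qed.

(* Pigeonhole: (xR + B)^(t + k) lies in x^t R + B^k when B is generated by the
   remaining generators. *)
Lemma ideal_gen_pow_split r (g : 'I_r.+1 -> R) t k z :
  ideal_pow (ideal_gen g) (t + k) z ->
  exists x y, ideal_pow (ideal_gen (fun i => g (lift ord0 i))) k y /\
              z = g ord0 ^+ t * x + y.
Proof.
set B := ideal_gen (fun i => g (lift ord0 i)).
have Bid : is_ideal B by apply: ideal_gen_ideal.
pose S t k z := exists x y, ideal_pow B k y /\ z = g ord0 ^+ t * x + y.
have Sid t' k' : is_ideal (S t' k').
  case: (ideal_pow_ideal k' Bid) => P0 PD PM; split.
  - by exists 0, 0; split; rewrite // mulr0 addr0.
  - move=> _ _ [x1 [y1 [By1 ->]]] [x2 [y2 [By2 ->]]]; exists (x1 + x2), (y1 + y2).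
    by split; [apply: PD | rewrite mulrDr addrACA].
  - move=> u _ [x [y [By ->]]]; exists (u * x), (u * y).
    by split; [apply: PM | rewrite mulrDr mulrCA].
rewrite -/(S t k z); have [q qE] : exists q, q = (t + k)%N by eexists.
rewrite -qE; elim: q t k z qE => [|q IHq] t k z.
  move=> /esym/eqP; rewrite addn_eq0 => /andP[/eqP-> /eqP->] _.
  by exists z, 0; rewrite expr0 mul1r addr0.
case: t => [|t] qE.
  move=> _; exists z, 0; rewrite expr0 mul1r addr0; split=> //.
  by case: (ideal_pow_ideal k Bid).
case: k qE => [|k] qE; first by move=> _; exists 0, z; rewrite mulr0 add0r.
apply: ideal_mul_min => // _ w [u ->] Bw.
(* The factor taken from $B+xR$ splits in two: its $x$-part raises the exponent of $x$, so $w$ is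
   split at $(t,k+1)$; its $B$-part raises the power of $B$, so $w$ is split at $(t+1,k)$. *)
rewrite big_ord_recl mulrDl; case: (Sid t.+1 k.+1) => _ SD _; apply: SD.
  have [|x [y [By ->]]] := IHq t k.+1 w _ Bw; first by apply: succn_inj; rewrite qE.
  exists (u ord0 * x), (u ord0 * g ord0 * y); split.
    by case: (ideal_pow_ideal k.+1 Bid) => _ _; apply.
  by rewrite mulrDr exprS -!mulrA; congr (_ + _); rewrite mulrCA; congr (_ * _); rewrite mulrCA.
have [|x [y [By ->]]] := IHq t.+1 k w _ Bw; first by apply: succn_inj; rewrite qE addnS.
rewrite mulrDr; exists ((\sum_i u (lift ord0 i) * g (lift ord0 i)) * x),
  ((\sum_i u (lift ord0 i) * g (lift ord0 i)) * y); split.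
  by apply: mem_ideal_mul => //; exists (fun i => u (lift ord0 i)).
by rewrite mulrCA.
Qed.

(** * Submodules of free modules and the filtration by powers of an ideal *)

Section Submodules.
Variable n : nat.
Implicit Types (K L U D : 'rV[R]_n -> Prop) (v w : 'rV[R]_n).

Lemma submodB K v w : is_submod K -> K v -> K w -> K (v - w).
Proof. by move=> [_ KD KZ] Kv Kw; apply: KD => //; rewrite -scaleN1r; apply: KZ. Qed.

Lemma submod_sum K r (f : 'I_r -> 'rV[R]_n) :
  is_submod K -> (forall i, K (f i)) -> K (\sum_i f i).
Proof. by move=> [K0 KD _] Kf; elim/big_ind: _ => // i _; apply: Kf. Qed.

Lemma submod_mulmx K r (u : 'rV[R]_r) (A : 'M[R]_(r, n)) :
  is_submod K -> (forall i, K (row i A)) -> K (u *m A).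
Proof.
by move=> Ks KA; rewrite mulmx_sum_row; apply: submod_sum => // i; case: Ks => _ _; apply.
Qed.

Definition submod_add K L v := exists u w, [/\ K u, L w & v = u + w].

Lemma submod_addP K L : is_submod K -> is_submod L -> is_submod (submod_add K L).
Proof.
move=> [K0 KD KZ] [L0 LD LZ]; split.
- by exists 0, 0; rewrite addr0.
- move=> _ _ [u1 [w1 [Ku1 Lw1 ->]]] [u2 [w2 [Ku2 Lw2 ->]]].
  by exists (u1 + u2), (w1 + w2); rewrite addrACA; split=> //; [apply: KD | apply: LD].
- move=> x _ [u [w [Ku Lw ->]]].
  by exists (x *: u), (x *: w); rewrite scalerDr; split=> //; [apply: KZ | apply: LZ].
Qed.

Lemma mx_im_submod r (A : 'M[R]_(r, n)) : is_submod (mx_im A).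
Proof.
split.
- by exists 0; rewrite mul0mx.
- by move=> _ _ [u ->] [w ->]; exists (u + w); rewrite mulmxDl.
- by move=> x _ [u ->]; exists (x *: u); rewrite scalemxAl.
Qed.

Lemma mx_im_row r (A : 'M[R]_(r, n)) i : mx_im A (row i A).
Proof. by exists (delta_mx 0 i); rewrite rowE. Qed.

Lemma mx_ker_submod r (A : 'M[R]_(n, r)) : is_submod (mx_ker A).
Proof.
rewrite /mx_ker; split.
- by rewrite mul0mx.
- by move=> v w v0 w0; rewrite mulmxDl v0 w0 addr0.
- by move=> x v v0; rewrite -scalemxAl v0 scaler0.
Qed.

Lemma smul_min I K L :
  is_submod L -> (forall x v, I x -> K v -> L (x *: v)) -> forall v, smul I K v -> L v.
Proof.
by move=> Ls IKL v [r [x [w [Ix Kw ->]]]]; apply: submod_sum => // i; apply: IKL.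
Qed.

Lemma mem_smul I K x v : I x -> K v -> smul I K (x *: v).
Proof.
by move=> Ix Kv; exists 1%N, (fun=> x), (fun=> v); split=> //; rewrite big_ord1.
Qed.

Lemma smul_submod I K : is_ideal I -> is_submod (smul I K).
Proof.
move=> [I0 ID IM]; split.
- by exists 0%N, (fun=> 0), (fun=> 0); split; rewrite ?big_ord0 //; case.
- move=> x y [r1 [u1 [w1 [Iu1 Jw1 ->]]]] [r2 [u2 [w2 [Iu2 Jw2 ->]]]].
  exists (r1 + r2)%N, (fun i => match split i with inl j => u1 j | inr j => u2 j end),
    (fun i => match split i with inl j => w1 j | inr j => w2 j end).
  split=> [i|i|]; try by case: (split i).
  rewrite big_split_ord /=; congr (_ + _); apply: eq_bigr => i _.
    by rewrite -[lshift _ _]/(unsplit (inl i)) unsplitK.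
  by rewrite -[rshift _ _]/(unsplit (inr i)) unsplitK.
- move=> x y [r [u [w [Iu Jw ->]]]]; exists r, (fun i => x * u i), w.
  by split=> // [i|]; [apply: IM | rewrite scaler_sumr; apply: eq_bigr => i _; rewrite scalerA].
Qed.

Lemma smul_mx_im I r (A : 'M[R]_(r, n)) v :
  is_ideal I -> smul I (mx_im A) v -> exists2 u : 'rV[R]_r, (forall j, I (u 0 j)) & v = u *m A.
Proof.
move=> [I0 ID IM]; move: v; apply: smul_min => [|x _ Ix [u ->]].
  split.
  - by exists 0; rewrite ?mul0mx // => j; rewrite mxE.
  - move=> _ _ [u Iu ->] [w Iw ->]; exists (u + w); rewrite ?mulmxDl // => j.
    by rewrite mxE; apply: ID.
  - move=> x _ [u Iu ->]; exists (x *: u); rewrite ?scalemxAl // => j.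
    by rewrite mxE; apply: IM.
by exists (x *: u); rewrite ?scalemxAl // => j; rewrite mxE mulrC; apply: IM.
Qed.

Lemma mpowFE I k v : is_ideal I -> mpowF I k n v <-> forall j, ideal_pow I k (v 0 j).
Proof.
move=> Iid; have kid := ideal_pow_ideal k Iid; split=> [|Iv].
  move: v; apply: smul_min => [|x v Ix _ j].
    case: kid => k0 kD kM; split=> [j|v w Iv Iw j|x v Iv j]; rewrite mxE //.
      exact: kD.
    exact: kM.
  by rewrite mxE mulrC; case: kid => _ _; apply.
rewrite [v]row_sum_delta; apply: submod_sum; first exact: smul_submod.
by move=> j; apply: mem_smul.
Qed.

Lemma mpowF_submod I k : is_ideal I -> is_submod (mpowF I k n).
Proof. by move=> Iid; apply: smul_submod; apply: ideal_pow_ideal. Qed.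

Lemma mpowF_le I j k v : is_ideal I -> (j <= k)%N -> mpowF I k n v -> mpowF I j n v.
Proof.
by move=> Iid jk /(mpowFE k v Iid) Iv; apply/(mpowFE j v Iid) => i; apply: ideal_pow_le (Iv i).
Qed.

Lemma mpowFZ I j k x v :
  is_ideal I -> ideal_pow I j x -> mpowF I k n v -> mpowF I (j + k) n (x *: v).
Proof.
move=> Iid Ix /(mpowFE k v Iid) Iv; apply/(mpowFE _ _ Iid) => i.
by rewrite mxE; apply: ideal_powD.
Qed.

End Submodules.

Lemma mpowF_mulmx I j k r n (u : 'rV[R]_r) (A : 'M[R]_(r, n)) :
  is_ideal I -> mpowF I j r u -> (forall i, mpowF I k n (row i A)) ->
  mpowF I (j + k) n (u *m A).
Proof.
move=> Iid /(mpowFE j u Iid) Iu IA; rewrite mulmx_sum_row.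
by apply: submod_sum => [|i]; [apply: mpowF_submod | apply: mpowFZ].
Qed.

(** * Finite generation and the ascending chain condition *)

Section Noetherian.
Hypothesis noethR : noetherian R.

(** Induction on the rank. The first coordinates of $K$ form an ideal, generated by those of
    finitely many [f i] in $K$; subtracting a combination of the [f i] leaves an element with first
    coordinate zero, to which the induction hypothesis applies. *)
Lemma submod_fg n (K : 'rV[R]_n -> Prop) :
  is_submod K -> exists r (G : 'M[R]_(r, n)), seteq K (mx_im G).
Proof.
elim: n K => [|n IHn] K Ks.
  exists 0%N, 0 => v; split=> _; last by rewrite [v]thinmx0; case: Ks.
  by exists 0; rewrite [v]thinmx0 mul0mx.
have [K0 KD KZ] := Ks.
pose I x := exists2 v, K v & v 0 ord0 = x.
have Iid : is_ideal I.
  split.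
  - by exists 0; rewrite ?mxE.
  - by move=> _ _ [v Kv <-] [w Kw <-]; exists (v + w); rewrite ?mxE //; apply: KD.
  - by move=> x _ [v Kv <-]; exists (x *: v); rewrite ?mxE //; apply: KZ.
have [r1 [g gE]] := noethR Iid.
have /fin_all_exists2[f fK fg] i : exists2 v, K v & v 0 ord0 = g i.
  by apply/(gE _).2; apply: mem_ideal_gen.
pose emb (w : 'rV[R]_n) : 'rV[R]_(1 + n) := row_mx 0 w.
have [] := IHn (fun w => K (emb w)).
  rewrite /emb; split.
  - by rewrite row_mx0.
  - by move=> v w Kv Kw; rewrite -[X in row_mx X](addr0 0) -add_row_mx; apply: KD.
  - by move=> x v Kv; rewrite -[X in row_mx X](scaler0 _ x) -scale_row_mx; apply: KZ.
move=> r2 [H HE]; pose G1 : 'M[R]_(r1, 1 + n) := \matrix_(i, j) f i 0 j.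
exists (r1 + r2)%N, (col_mx G1 (row_mx 0 H)) => v; split; last first.
  move=> [u ->]; apply: submod_mulmx => // i; case: (splitP i) => k ik.
    have ->: i = lshift r2 k by apply: val_inj.
    rewrite rowKu; suff -> : row k G1 = f k by [].
    by apply/rowP => j; rewrite !mxE.
  have ->: i = rshift r1 k by apply: val_inj.
  have -> : row (rshift r1 k) (col_mx G1 (row_mx 0 H)) = emb (row k H).
    by rewrite rowKd /emb row_row_mx row0.
  by apply/HE; apply: mx_im_row.
move=> Kv; have [c vc] := (gE (v 0 ord0)).1 (ex_intro2 _ _ v Kv erefl).
pose cr : 'rV[R]_r1 := \row_i c i.
have cG : K (cr *m G1).
  apply: submod_mulmx => // i; suff -> : row i G1 = f i by [].
  by apply/rowP => j; rewrite !mxE.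
have wE : v - cr *m G1 = emb (rsubmx (v - cr *m G1 : 'rV_(1 + n))).
  apply: (etrans (esym (@hsubmxK _ 1 1 n _))).
  apply: (congr1 (fun z : 'rV_1 => row_mx z _)); apply/rowP => j.
  rewrite !mxE (_ : lshift n j = ord0); last by apply: val_inj; rewrite /= (ord1 j).
  by rewrite vc; apply/eqP; rewrite subr_eq0; apply/eqP/eq_bigr => i _; rewrite !mxE fg.
have [|u uE] := (HE (rsubmx (v - cr *m G1 : 'rV_(1 + n)))).1; first by rewrite -wE; apply: submodB.
have uHE : u *m row_mx 0 H = emb (u *m H) by rewrite /emb mul_mx_row mulmx0.
by exists (row_mx cr u); rewrite mul_row_col uHE -uE -wE addrC subrK.
Qed.

(** The union of the chain is finitely generated, and its generators all occur at one stage. *)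
Lemma submod_acc n (K : nat -> 'rV[R]_n -> Prop) :
  (forall i, is_submod (K i)) -> (forall i v, K i v -> K i.+1 v) ->
  exists i, forall j v, K j v -> K i v.
Proof.
move=> Ks Kincr.
have Kle i j v : (i <= j)%N -> K i v -> K j v.
  by move=> /subnK <-; elim: (j - i)%N => // k IHk /IHk; apply: Kincr.
pose U v := exists i, K i v.
have Us : is_submod U.
  split.
  - by exists 0%N; case: (Ks 0%N).
  - move=> v w [i Kv] [j Kw]; exists (maxn i j); case: (Ks (maxn i j)) => _ KD _.
    by apply: KD; [apply: Kle Kv; apply: leq_maxl | apply: Kle Kw; apply: leq_maxr].
  - by move=> x v [i Kv]; exists i; case: (Ks i) => _ _; apply.
have [r [G GE]] := submod_fg Us.
have /fin_all_exists[f fK] i : exists k, K k (row i G).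
  by apply/(GE _).2; apply: mx_im_row.
exists (\max_i f i) => j v Kv.
have [u ->] := (GE v).1 (ex_intro _ j Kv).
by apply: submod_mulmx => // i; apply: Kle (fK i); apply: leq_bigmax.
Qed.

End Noetherian.

(** * Units and Nakayama's lemma over a local ring *)

Section Local.
Variable m : R -> Prop.
Hypothesis mloc : is_local_ring m.

Lemma local_ideal : is_ideal m. Proof. by case: mloc => [[]]. Qed.
Local Notation mid := local_ideal.

Lemma local_unit x : ~ m x -> exists y, y * x = 1.
Proof.
move=> nmx; have [[_ _] mmax] := mloc.
pose I z := exists y, z = y * x.
have Iid : is_ideal I.
  split; first by exists 0; rewrite mul0r.
    by move=> _ _ [u ->] [w ->]; exists (u + w); rewrite mulrDl.
  by move=> u _ [w ->]; exists (u * w); rewrite mulrA.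
apply: NNPP => nx; apply: nmx; apply: (mmax I); last by exists 1; rewrite mul1r.
by split=> // -[y yE]; apply: nx; exists y.
Qed.

Lemma local_unit1 x : m (x - 1) -> exists y, y * x = 1.
Proof.
move=> mx1; apply: local_unit => mx; have [[_ m1] _] := mloc; apply: m1.
have -> : 1 = x - (x - 1) by rewrite opprB addrCA subrr addr0.
by apply: idealB => //; apply: local_ideal.
Qed.

(** In the expansion along the first row, only the diagonal term survives modulo $\mathfrak{m}$. *)
Lemma det_congr1 r (A : 'M[R]_r) : (forall i j, m ((A - 1%:M) i j)) -> m (\det A - 1).
Proof.
have [m0 mD mM] := mid; elim: r A => [|r IHr] A mA.
  by rewrite det_mx00 subrr.
rewrite (expand_det_row A ord0) big_ord_recl.
rewrite addrAC; apply: (mD); last first.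
  apply: ideal_sum mid _ => i; rewrite mulrC; apply: mM.
  by have := mA ord0 (lift ord0 i); rewrite !mxE /= subr0.
have mdet : m (\det (row' ord0 (col' ord0 A)) - 1).
  apply: IHr => i j; have := mA (lift ord0 i) (lift ord0 j).
  by rewrite !mxE (inj_eq lift_inj).
rewrite /cofactor expr0 mul1r; set D := \det _ in mdet *.
have -> : A ord0 ord0 * D - 1 = D * ((A - 1%:M) ord0 ord0) + (D - 1).
  by rewrite !mxE eqxx mulrBr mulr1 addrA subrK mulrC.
by apply: mD => //; apply: mM.
Qed.

(** The rows of $(1-C)G$ lie in $U$, and $\det(1-C)$ is a unit, so the adjugate of $1-C$ recovers
    the rows of $G$ from them. *)
Lemma nakayama n (U : 'rV[R]_n -> Prop) r (G : 'M[R]_(r, n)) (C : 'M[R]_r) :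
  is_submod U -> (forall i j, m (C i j)) -> (forall i, U (row i (G - C *m G))) ->
  forall i, U (row i G).
Proof.
move=> Us mC UG i.
have [y yE] : exists y, y * \det (1%:M - C) = 1.
  apply: local_unit1; apply: det_congr1 => k l; rewrite addrAC subrr add0r mxE.
  by rewrite -mulN1r; case: mid => _ _; apply.
have -> : row i G = (y *: row i (\adj (1%:M - C))) *m (G - C *m G).
  rewrite -scalemxAl -row_mul -[X in _ *m (X - _)]mul1mx -mulmxBl mulmxA mul_adj_mx mul_scalar_mx.
  by apply/rowP => j; rewrite !mxE mulrA yE mul1r.
exact: submod_mulmx.
Qed.


(** * Krull's intersection theorem *)

Section Krull.
Hypothesis noethR : noetherian R.
Variable n : nat.

(* If the chain (K : x^i) is stationary from i = t on, then v = k + x^t y in D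
   gives x v in W <= K, so x^(t+1) y, hence x^t y, hence v lies in K. *)
Lemma krull_step (D W K : 'rV[R]_n -> Prop) x :
  is_submod K -> (forall v, W v -> K v) -> (forall v, D v -> W (x *: v)) ->
  (forall v, K v -> D v -> W v) ->
  exists t, forall v, submod_add K (fun w => exists y, w = x ^+ t *: y) v -> D v -> W v.
Proof.
move=> Ks WK xDW KDW; have [K0 KD KZ] := Ks.
have [|i y Ky|t tmax] := submod_acc noethR (K := fun i y => K (x ^+ i *: y)).
- move=> i; split=> [|v w Kv Kw|y v Kv]; first by rewrite scaler0.
    by rewrite scalerDr; apply: KD.
  by rewrite scalerA mulrC -scalerA; apply: KZ.
- by rewrite exprS -scalerA; apply: KZ.
exists t => _ [k [_ [Kk [y ->] ->]]] Dv; apply: KDW => //; apply: (KD) => //.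
apply: (tmax t.+1); rewrite exprS -scalerA.
have -> : x *: (x ^+ t *: y) = x *: (k + x ^+ t *: y) - x *: k.
  by rewrite scalerDr addrAC subrr add0r.
by apply: submodB => //; [apply/WK/xDW | apply: KZ].
Qed.

(** Induction on the number of generators: [krull_step] removes the generator $x$ at the price of
    enlarging $K$ to $K+x^tF$, which still meets $D$ inside $W$. With no generators left, the ideal
    is zero and $D\subseteq K$. *)
Lemma krull_aux (D W : 'rV[R]_n -> Prop) r (g : 'I_r -> R) (K : 'rV[R]_n -> Prop) :
  is_submod K -> (forall v, W v -> K v) -> (forall i v, D v -> W (g i *: v)) ->
  (forall v, K v -> D v -> W v) ->
  (forall k v, D v -> submod_add K (mpowF (ideal_gen g) k n) v) ->
  forall v, D v -> W v.
Proof.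
elim: r g K => [|r IHr] g K Ks WK gDW KDW DK.
  move=> v Dv; apply: KDW => //.
  have [u [w [Ku /(mpowFE _ _ (ideal_gen_ideal g)) gw ->]]] := DK 1%N v Dv.
  suff -> : w = 0 by rewrite addr0.
  apply/rowP => j; rewrite mxE; move: (gw j).
  apply: (ideal_mul_min (K := fun x => x = 0)) => [|x y [c ->] _].
    by split=> [//|x y -> ->|x y ->]; rewrite ?addr0 ?mulr0.
  by rewrite big_ord0 mul0r.
have [t tP] := krull_step Ks WK (gDW ord0) KDW.
set K1 := submod_add K _ in tP.
have K1s : is_submod K1.
  apply: submod_addP => //; split.
  - by exists 0; rewrite scaler0.
  - by move=> _ _ [y1 ->] [y2 ->]; exists (y1 + y2); rewrite scalerDr.
  - by move=> x _ [y ->]; exists (x *: y); rewrite !scalerA mulrC.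
apply: (IHr (fun i => g (lift ord0 i)) K1) => //.
- move=> v /WK Kv; exists v, 0; rewrite addr0; split=> //.
  by exists 0; rewrite scaler0.
- by move=> i v; apply: gDW.
(* The exponent $t+k$ lets [ideal_gen_pow_split] cut each coordinate into a multiple of $x^t$,
   absorbed by [K1], and an element of the $k$-th power of the remaining ideal. *)
move=> k v Dv; have [u [w [Ku /(mpowFE _ _ (ideal_gen_ideal g)) gw ->]]] := DK (t + k)%N v Dv.
have /fin_all_exists[f fP] j := ideal_gen_pow_split (gw j).
have /fin_all_exists[h hP] := fP.
exists (u + g ord0 ^+ t *: \row_j f j), (\row_j h j); split.
- by exists u, (g ord0 ^+ t *: \row_j f j); split=> //; exists (\row_j f j).
- by apply/mpowFE => [|j]; rewrite ?mxE; [apply: ideal_gen_ideal | case: (hP j)].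
- by rewrite -addrA; congr (_ + _); apply/rowP => j; rewrite !mxE; case: (hP j).
Qed.

(* With D the intersection of all U + m^k F, the previous lemma applied to
   W = U + m D gives D = U + m D. *)
Lemma krull (U : 'rV[R]_n -> Prop) v :
  is_submod U -> (forall k, submod_add U (mpowF m k n) v) -> U v.
Proof.
move=> Us; pose D v := forall k, submod_add U (mpowF m k n) v.
rewrite -/(D v) => Dv; have mI := local_ideal.
have Uk k : is_submod (submod_add U (mpowF m k n)).
  by apply: submod_addP => //; apply: mpowF_submod.
have Ds : is_submod D.
  split=> [k|u w Du Dw k|x u Du k]; case: (Uk k) => // _ UD UZ; first exact: UD.
  exact: UZ.
pose W := submod_add U (smul m D).
have Ws : is_submod W by apply: submod_addP => //; apply: smul_submod.
have [r [g gE]] := noethR mI.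
have DW w : D w -> W w.
  apply: (@krull_aux D W r g W) => // [i u Du|k u Du].
    exists 0, (g i *: u); rewrite add0r; split=> //; first by case: Us.
    by apply: mem_smul => //; apply/gE; apply: mem_ideal_gen.
  have [u1 [u2 [Uu1 mu2 ->]]] := Du k; exists u1, u2; split=> //.
    by exists u1, 0; rewrite addr0; split=> //; case: (smul_submod D mI).
  move/(mpowFE _ _ mI): mu2 => mu2; apply/(mpowFE _ _ (ideal_gen_ideal g)) => j.
  by apply: ideal_pow_mono (mu2 j) => x /gE.
have [q [G GE]] := submod_fg noethR Ds.
(* From $D=U+\mathfrak{m}D$, each generator of $D$ is, modulo $U$, a combination of the generators
   with coefficients in $\mathfrak{m}$; these form the matrix for [nakayama]. *)
have /fin_all_exists[C CP] i : exists c : 'rV[R]_q, (forall j, m (c 0 j)) /\ U (row i G - c *m G).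
  have [u [w [Uu mw ->]]] := DW _ ((GE _).2 (mx_im_row G i)).
  have [|c mc ->] := smul_mx_im (A := G) (v := w) mI.
    apply: smul_min mw; first exact: smul_submod.
    by move=> x y mx /GE; apply: mem_smul.
  by exists c; rewrite addrK.
have [c ->] := (GE v).1 Dv; apply: submod_mulmx => //.
apply: (nakayama (C := \matrix_i C i)) => // i => [j|].
  by have [mC _] := CP i; rewrite mxE.
by rewrite linearB /= row_mul rowK; have [_] := CP i.
Qed.

End Krull.

(** * Initial modules and Artin-Rees numbers under perturbation *)

Section Approximation.
Hypothesis noethR : noetherian R.
Local Notation mid := local_ideal.

(* Only the nontrivial inclusion of [AR_holds]. *)
Definition ar_bound n (L : 'rV[R]_n -> Prop) s :=
  forall k v, (s <= k)%N -> mpowF m k n v -> L v ->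
    smul (ideal_pow m (k - s)) (fun w => mpowF m s n w /\ L w) v.

(** The inclusion $L^*\subseteq L'^*$, expressed on representatives. *)
Definition sub_initial n (L L' : 'rV[R]_n -> Prop) :=
  forall k v, L v -> mpowF m k n v ->
    exists w, [/\ L' w, mpowF m k n w & mpowF m k.+1 n (v - w)].

Lemma same_initialP n (L L' : 'rV[R]_n -> Prop) :
  same_initial m L L' <-> sub_initial L L' /\ sub_initial L' L.
Proof.
have ms k := mpowF_submod n k mid.
have sub (K K' : 'rV[R]_n -> Prop) :
    (forall k v, initial_comp m K k v -> initial_comp m K' k v) <-> sub_initial K K'.
  split=> [KK' k v Kv mv|KK' k _ [x [y [Kx mx my ->]]]].
    have [|x [y [K'x mx my ->]]] := KK' k v.
      by exists v, 0; rewrite addr0; split=> //; case: (ms k.+1).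
    by exists x; split=> //; rewrite addrAC subrr add0r.
  have [w [K'w mw mxw]] := KK' k x Kx mx.
  exists w, ((x - w) + y); split=> //; last by rewrite addrA [w + _]addrC subrK.
  by case: (ms k.+1) => _ mD _; apply: mD.
split=> [LL'|[/sub LL' /sub L'L] k v]; last by split; [apply: LL' | apply: L'L].
by split; apply/sub => k v /LL'.
Qed.

Lemma sub_initial_trans n (L1 L2 L3 : 'rV[R]_n -> Prop) :
  sub_initial L1 L2 -> sub_initial L2 L3 -> sub_initial L1 L3.
Proof.
move=> L12 L23 k v Lv mv; have [w [Lw mw mvw]] := L12 k v Lv mv.
have [u [Lu mu mwu]] := L23 k w Lw mw; exists u; split=> //.
have -> : v - u = (v - w) + (w - u) by rewrite addrA subrK.
by case: (mpowF_submod n k.+1 mid) => _ mD _; apply: mD.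
Qed.

Lemma sub_initial_le n (L L' : 'rV[R]_n -> Prop) :
  (forall v, L v -> L' v) -> sub_initial L L'.
Proof.
move=> LL' k v Lv mv; exists v; rewrite subrr; split=> //; first exact: LL'.
by case: (mpowF_submod n k.+1 mid).
Qed.

(** Successive approximation: if $v-u\in\mathfrak{m}^kF$ with $u\in L'$, then $v-u\in L$, and an
    element of $L'$ with the same initial form pushes the error into $\mathfrak{m}^{k+1}F$. Krull's
    theorem for $L'$ concludes. *)
Lemma sub_initial_eq n (L L' : 'rV[R]_n -> Prop) :
  is_submod L -> is_submod L' -> (forall v, L' v -> L v) -> sub_initial L L' ->
  forall v, L v -> L' v.
Proof.
move=> Ls L's L'L LL' v Lv; apply: krull => // k.
elim: k => [|k [u [w [L'u mw vE]]]].
  by exists 0, v; rewrite add0r; split=> //; [case: L's | apply/(mpowFE _ _ mid)].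
have [|w' [L'w' _ mw']] := LL' k w _ mw.
  have -> : w = v - u by rewrite vE addrAC subrr add0r.
  by apply: submodB => //; apply: L'L.
exists (u + w'), (w - w'); split=> //; first by case: L's => _ L'D _; apply: L'D.
by rewrite vE -addrA [w' + _]addrC subrK.
Qed.

(* The initial module of L is generated in degrees at most s < M, where
   perturbations in m^M are invisible. *)
Lemma sub_initial_perturb n (L L' : 'rV[R]_n -> Prop) s M :
  is_submod L' -> ar_bound L s -> (s < M)%N ->
  (forall v, L v -> exists2 w, L' w & mpowF m M n (v - w)) -> sub_initial L L'.
Proof.
move=> L's Ls sM LL' k v Lv mv; have ms j := mpowF_submod n j mid.
case: (ltnP k s) => [ks|sk].
  have [w L'w mvw] := LL' v Lv; exists w; split=> //.
    have -> : w = v - (v - w) by rewrite opprB addrCA subrr addr0.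
    apply: submodB => //; apply: mpowF_le mid _ mvw.
    by apply: leq_trans (ltnW sM); apply: ltnW.
  by apply: mpowF_le mid _ mvw; apply: leq_trans ks (ltnW sM).
pose T w := exists u, [/\ L' u, mpowF m k n u & mpowF m k.+1 n (w - u)].
have [L'0 L'D L'Z] := L's.
have Ts : is_submod T.
  case: (ms k) => k0 kD kZ; case: (ms k.+1) => K0 KD KZ; split.
  - by exists 0; rewrite subrr.
  - move=> v1 v2 [u1 [L1 m1 d1]] [u2 [L2 m2 d2]]; exists (u1 + u2).
    by split; [apply: L'D | apply: kD | rewrite opprD addrACA; apply: KD].
  - move=> x v1 [u1 [L1 m1 d1]]; exists (x *: u1).
    by split; [apply: L'Z | apply: kZ | rewrite -scalerBr; apply: KZ].
apply: (smul_min Ts) (Ls k v sk mv Lv) => x w mx [mw Lw].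
have [u L'u mwu] := LL' w Lw; exists (x *: u); split; first exact: L'Z.
  rewrite -(subnK sk); apply: mpowFZ => //; first exact: mid.
  have -> : u = w - (w - u) by rewrite opprB addrCA subrr addr0.
  by apply: submodB => //; apply: mpowF_le mid _ mwu; apply: ltnW.
rewrite -scalerBr; apply: mpowF_le mid _ (mpowFZ mid mx mwu).
by rewrite -(subnK sk) -addnS subnK // leq_add2l.
Qed.

(** An element of $L'\cap\mathfrak{m}^jF$ is replaced by one of $L$ with the same initial form,
    expanded there by the Artin-Rees property as a sum of terms $xf$, and each $f$ is replaced by
    some $g\in L'$. The errors $x(f-g)$ lie in $\mathfrak{m}^{(j-s)+(s+1)}F=\mathfrak{m}^{j+1}F$,
    and Krull's theorem removes them in the limit. *)
Lemma ar_bound_transfer n (L L' : 'rV[R]_n -> Prop) s :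
  is_submod L' -> sub_initial L L' -> sub_initial L' L -> ar_bound L s -> ar_bound L' s.
Proof.
move=> L's LL' L'L Ls k v sk mv L'v.
set U := smul _ _; have ms j := mpowF_submod n j mid.
have Us : is_submod U by apply: smul_submod; apply: ideal_pow_ideal mid.
have UL' : forall w, U w -> L' w.
  by apply: smul_min => // x w _ [_ L'w]; case: L's => _ _; apply.
(* [LU] corrects a single degree; iterating it from degree $k$ upwards puts $v$ in
   $U+\mathfrak{m}^jF$ for every $j$. *)
suff LU j w : (k <= j)%N -> mpowF m j n w -> L' w -> submod_add U (mpowF m j.+1 n) w.
  apply: krull => // j; case: (leqP j k) => [jk|/ltnW kj].
    by exists 0, v; rewrite add0r; split=> //; [case: Us | apply: mpowF_le mid jk mv].
  rewrite -(subnKC kj); elim: (j - k)%N => [|i [u [w [Uu mw vE]]]].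
    by exists 0, v; rewrite add0r addn0; split=> //; case: Us.
  have [|u' [w' [Uu' mw' wE]]] := LU _ w (leq_addr i k) mw.
    have -> : w = v - u by rewrite vE addrAC subrr add0r.
    by apply: submodB => //; apply: UL'.
  exists (u + u'), w'; rewrite addnS; split=> //; last by rewrite vE wE addrA.
  by case: Us => _ UD _; apply: UD.
move=> kj mw L'w; have sj := leq_trans sk kj.
have [w1 [Lw1 mw1 mww1]] := L'L j w L'w mw.
pose T := submod_add U (mpowF m j.+1 n).
have Ts : is_submod T by apply: submod_addP.
have [_ TD _] := Ts.
rewrite -/(T w) -[w](subrK w1); apply: TD.
  by exists 0, (w - w1); rewrite add0r; split=> //; case: Us.
apply: (smul_min Ts) (Ls j w1 sj mw1 Lw1) => x f mx [mf Lf].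
have [g [L'g mg mfg]] := LL' s f Lf mf.
exists (x *: g), (x *: (f - g)); split.
- apply: mem_smul => //; apply: ideal_pow_le mid _ mx; exact: leq_sub2r.
- by have := mpowFZ mid mx mfg; rewrite addnS subnK.
- by rewrite -scalerDr addrC subrK.
Qed.

(** Each row of $A$ is moved into $L'$ by an element of $\mathfrak{m}^MF$, so
    $\operatorname{im}(A+E)\subseteq L'$. Equality follows from [sub_initial_eq] and
    $L'^*\subseteq(\operatorname{im}A)^*\subseteq(\operatorname{im}(A+E))^*$, the second inclusion
    being [sub_initial_perturb]. *)
Lemma lift_generators r n (A : 'M[R]_(r, n)) (L' : 'rV[R]_n -> Prop) s M :
  is_submod L' -> sub_initial L' (mx_im A) -> ar_bound (mx_im A) s -> (s < M)%N ->
  (forall v, mx_im A v -> exists2 w, L' w & mpowF m M n (v - w)) ->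
  exists E : 'M[R]_(r, n), (forall i, mpowF m M n (row i E)) /\ seteq (mx_im (A + E)) L'.
Proof.
move=> L's L'A As sM AL'.
have /fin_all_exists2[f fL' fm] i := AL' _ (mx_im_row A i).
pose E : 'M[R]_(r, n) := \matrix_i (f i - row i A); exists E.
have mE i : mpowF m M n (row i E).
  by rewrite rowK -opprB -scaleN1r; case: (mpowF_submod n M mid) => _ _; apply.
have AEL' : forall v, mx_im (A + E) v -> L' v.
  by move=> _ [u ->]; apply: submod_mulmx => // i; rewrite linearD /= rowK addrC subrK.
split=> // v; split; first exact: AEL'.
apply: sub_initial_eq => //; first exact: mx_im_submod.
apply: sub_initial_trans L'A _; apply: sub_initial_perturb As sM _; first exact: mx_im_submod.
move=> _ [u ->]; exists (u *m (A + E)); first by exists u.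
rewrite mulmxDr opprD addrA subrr add0r -mulmxN.
have -> : M = (0 + M)%N by [].
apply: mpowF_mulmx mid _ _ => [|i]; first by apply/(mpowFE _ _ mid).
by rewrite linearN -scaleN1r; case: (mpowF_submod n M mid) => _ _; apply; apply: mE.
Qed.

(** * Kernels of perturbed maps *)

Section Kernel.
Variables (r n s M : nat) (A E : 'M[R]_(r, n)).
Hypotheses (Es : ar_bound (mx_im (A + E)) s) (sM : (s < M)%N)
  (mE : forall i, mpowF m M n (row i E)).

(* If u A = 0 then u (A + E) = u E lies in m^(k + M) and in the image of A + E,
   hence equals w (A + E) with w in m^(k + M - s). *)
Lemma ker_perturb k u : mpowF m k r u -> mx_ker A u ->
  exists2 w, mx_ker (A + E) w & mpowF m (k + (M - s)) r (u - w).
Proof.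
move=> mu uA.
have mui : mpowF m (k + M) n (u *m (A + E)).
  by rewrite mulmxDr uA add0r; apply: mpowF_mulmx mid mu mE.
have skM : (s <= k + M)%N by apply: leq_trans (ltnW sM) (leq_addl _ _).
have [|w mw wE] := @smul_mx_im n (ideal_pow m (k + M - s)) r (A + E) (u *m (A + E))
  (ideal_pow_ideal _ mid).
  apply: smul_min (Es skM mui _) => [|x v mx [_ Ev]|]; last by exists u.
    by apply: smul_submod; apply: ideal_pow_ideal mid.
  exact: mem_smul.
exists (u - w); first by rewrite /mx_ker mulmxBl wE subrr.
rewrite opprB addrCA subrr addr0; apply/(mpowFE _ _ mid) => j.
by rewrite addnBA // ltnW.
Qed.

(** Since $s<M$, the correction made by [ker_perturb] lies in $\mathfrak{m}^{k+1}$ and leaves the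
    initial form in degree $k$ unchanged. *)
Lemma ker_sub_initial : sub_initial (mx_ker A) (mx_ker (A + E)).
Proof.
move=> k u uA mu; have [w wAE muw] := ker_perturb mu uA.
have muw1 : mpowF m k.+1 r (u - w).
  by apply: mpowF_le mid _ muw; rewrite -addn1 leq_add2l subn_gt0.
exists w; split=> //; have -> : w = u - (u - w) by rewrite opprB addrCA subrr addr0.
by apply: submodB => //; [apply: mpowF_submod mid | apply: mpowF_le mid (leqnSn k) muw1].
Qed.

End Kernel.

End Approximation.

(** * Hilbert functions and initial ideals *)

Section Hilbert.
Hypothesis noethR : noetherian R.
Local Notation mid := local_ideal.

(** Gaussian elimination over the residue field, clearing the first column with a pivot row and
    recursing on the other rows and columns. *)
Lemma residual_dependence t (A : 'I_t.+1 -> 'I_t -> R) :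
  exists c : 'I_t.+1 -> R, (exists i, ~ m (c i)) /\ forall j, m (\sum_i c i * A i j).
Proof.
have [m0 mD mM] := mid; elim: t A => [|t IHt] A.
  by exists (fun=> 1); split=> [|[]//]; exists ord0; case: mloc => [[]].
(* $v$ inverts the pivot. If the whole first column vanishes modulo $\mathfrak{m}$, then $v=0$ and
   any row may be set aside. *)
have [i0 [v vP]] : exists i0 v, forall i, m (A i ord0 - A i ord0 * v * A i0 ord0).
  have [mA|/not_all_ex_not[i0 /local_unit[v vA]]] := classic (forall i, m (A i ord0)).
    by exists ord0, 0 => i; rewrite mulr0 mul0r subr0.
  by exists i0, v => i; rewrite -mulrA vA mulr1 subrr.
pose B i j := A (lift i0 i) (lift ord0 j) - A (lift i0 i) ord0 * v * A i0 (lift ord0 j).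
have [c [[i1 ci1] cB]] := IHt B.
(* The coefficient at [i0] collects the multiples of the pivot row subtracted in [B]. *)
pose c' i := oapp c (- \sum_k c k * A (lift i0 k) ord0 * v) (unlift i0 i).
have sumE j : \sum_i c' i * A i j =
    \sum_k c k * (A (lift i0 k) j - A (lift i0 k) ord0 * v * A i0 j).
  rewrite (bigD1_ord i0) //= /c' unlift_none /= mulNr mulr_suml addrC -sumrB.
  by apply: eq_bigr => k _; rewrite liftK /= mulrBr !mulrA.
exists c'; split; first by exists (lift i0 i1); rewrite /c' liftK.
move=> j; rewrite sumE; have [j' ->|->] := unliftP ord0 j; first exact: cB.
by apply: ideal_sum mid _ => k; apply: mM.
Qed.

(** If $t$ elements generate $\mathfrak{m}^k$, then any $t+1$ classes satisfy a relation from
    [residual_dependence]. *)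
Lemma hilb_bounded J k : is_ideal J -> exists t, ~ hilb_ge m J k t.
Proof.
move=> Jid; have [t [g gE]] := noethR (ideal_pow_ideal k mid).
have [_ JD JM] := Jid; exists t.+1 => -[x [xJ xfree]].
have /fin_all_exists[A AP] i : exists a : 'I_t -> R, J (x i - \sum_j a j * g j).
  have [u [w [/gE[a ->] Jw ->]]] := xJ i.
  by exists a; rewrite addrAC subrr add0r.
have [c [[i ci] cA]] := residual_dependence A; apply: ci; move: i; apply: xfree.
exists (\sum_j (\sum_i c i * A i j) * g j), (\sum_i c i * (x i - \sum_j A i j * g j)).
split.
- apply: ideal_sum (ideal_pow_ideal _ mid) _ => j; apply: mem_ideal_mul => //.
  by apply/gE; apply: mem_ideal_gen.
- by apply: ideal_sum Jid _ => i; apply: JM.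
- have -> : \sum_j (\sum_i c i * A i j) * g j = \sum_i c i * \sum_j A i j * g j.
    under eq_bigr do rewrite mulr_suml; rewrite exchange_big; apply: eq_bigr => i _.
    by rewrite mulr_sumr; apply: eq_bigr => j _; rewrite mulrA.
  by rewrite -big_split /=; apply: eq_bigr => i _; rewrite -mulrDr addrC subrK.
Qed.

(* An initial form of J outside I^* would enlarge by one a maximal independent
   family of (R/J)_k to an independent family of (R/I)_k. *)
Lemma hilbert_sub_initial I J :
  is_ideal I -> is_ideal J -> same_hilbert m I J ->
  (forall k x, I x -> ideal_pow m k x -> exists2 y, J y & ideal_pow m k.+1 (x - y)) ->
  forall k x, J x -> ideal_pow m k x -> exists2 y, I y & ideal_pow m k.+1 (x - y).
Proof.
move=> Iid Jid IJ subIJ k z Jz mz; have [_ JD JM] := Jid; have [_ ID IM] := Iid.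
have [q0 qD qM] := ideal_pow_ideal k mid; have mk1 := ideal_pow_ideal k.+1 mid.
have [Q0 QD QM] := mk1.
(* [hilb_ge] only gives lower bounds, so the dimension $r$ of $(R/J)_k$ is recovered as a value at
   which it holds for the last time. *)
have [r [rJ rJ1]] : exists r, hilb_ge m J k r /\ ~ hilb_ge m J k r.+1.
  have [t nt] := hilb_bounded k Jid; apply: NNPP => nr.
  apply: nt; elim: t => [|t IHt]; first by exists (fun=> 0); split=> [[]|c _ []].
  by apply: NNPP => nt; apply: nr; exists t.
apply: NNPP => nz; apply/rJ1/IJ; have [x [xJ xfree]] := rJ.
have /fin_all_exists[a aP] i : exists u, ideal_pow m k u /\ J (x i - u).
  by have [u [w [mu Jw ->]]] := xJ i; exists u; rewrite addrAC subrr add0r.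
have afree (c : 'I_r -> R) : ideal_add (ideal_pow m k.+1) J (\sum_i c i * a i) ->
    forall i, m (c i).
  move=> [u [w [mu Jw cE]]]; apply: xfree.
  exists u, (w + \sum_i c i * (x i - a i)); split=> //.
    by apply: JD => //; apply: ideal_sum Jid _ => i; apply: JM; case: (aP i).
  rewrite addrA -cE -big_split /=; apply: eq_bigr => i _.
  by rewrite -mulrDr addrC subrK.
exists (fun i => oapp a z (unlift ord0 i)); split.
  move=> i; exists (oapp a z (unlift ord0 i)), 0; rewrite addr0; split=> //.
    by case: (unlift _ _) => [j|] //=; case: (aP j).
  by case: Iid.
move=> c [u [w [mu Iw]]]; rewrite big_ord_recl unlift_none /=.
under eq_bigr do rewrite liftK /=.
set S := \sum_i _ => cE.
have mS : ideal_pow m k S.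
  by apply: ideal_sum (ideal_pow_ideal k mid) _ => i; apply: qM; case: (aP i).
have mw : ideal_pow m k w.
  have -> : w = (c ord0 * z + S) - u by rewrite cE addrAC subrr add0r.
  apply: (idealB (ideal_pow_ideal k mid)); first by apply: qD => //; apply: qM.
  by apply: ideal_pow_le mid (leqnSn k) mu.
have [w' Jw' mww'] := subIJ k w Iw mw.
(* Modulo $\mathfrak{m}^{k+1}$, $w\in I$ may be replaced by $w'\in J$; as $z\in J$ too, the relation
   becomes one among the [a i] in $(R/J)_k$. *)
have mc i : m (c (lift ord0 i)).
  move: i; apply: (afree (fun i => c (lift ord0 i))); exists (u + (w - w')), (w' - c ord0 * z).
  split; [exact: QD | by apply: idealB Jid Jw' _; apply: JM |].
  by rewrite addrA -[u + _ + _]addrA subrK -cE addrAC subrr add0r.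
move=> i; have [i' ->|->] := unliftP ord0 i; first exact: mc.
(* If $c_0$ had an inverse $y$, then $yw\in I$ would agree with $z$ modulo $\mathfrak{m}^{k+1}$,
   against the choice of $z$. *)
apply: NNPP => /local_unit[y yc]; apply: nz; exists (y * w); first exact: IM.
have -> : z - y * w = y * (u - S).
  by rewrite -[z]mul1r -yc -mulrA -mulrBr; congr (_ * _); apply/eqP;
    rewrite subr_eq addrAC -cE addrK.
apply: QM; apply: (idealB mk1 mu); apply: ideal_sum mk1 _ => i'.
by apply: mem_ideal_mul; [apply: mc | case: (aP i')].
Qed.

End Hilbert.
End Local.

End Development.

(** * Construction of the perturbed resolution *)

Theorem theorem3p6 (R : comNzRingType) (m I : R -> Prop) (b : nat -> nat)
    (d : forall n, 'M[R]_(b n.+1, b n)) (s : nat -> nat) (p N0 N : nat) :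
  noetherian R -> is_local_ring m -> is_ideal I -> min_free_res m I d ->
  (forall n, is_AR m (mx_im (d n)) (s n)) ->
  (forall i, (i <= p)%N -> (s i < N0)%N) ->
  (N0 + \sum_(i < p) s i < N)%N ->
  forall J : R -> Prop, is_ideal J ->
  seteq (ideal_add J (ideal_pow m N)) (ideal_add I (ideal_pow m N)) ->
  same_hilbert m I J ->
  exists e : forall n, 'M[R]_(b n.+1, b n),
    [/\ (forall n, (n <= p)%N -> forall v : 'rV[R]_(b n.+1),
            mpowF m N0 (b n) (v *m e n)),
        (forall v : 'rV[R]_(b 0%N), mx_im (d 0%N + e 0%N) v <-> forall j, J (v 0 j)),
        (forall n, (n < p)%N ->
            seteq (mx_ker (d n + e n)) (mx_im (d n.+1 + e n.+1)))
      & (forall n, (n <= p)%N -> same_initial m (mx_im (d n)) (mx_im (d n + e n)))].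
Proof.
move=> noethR mloc Iid [b0 dI dex _] ARd sN0 N0N J Jid JI hilb.
have mid := local_ideal mloc.
have ard n : ar_bound m (mx_im (d n)) (s n).
  by move=> k v sk mv Lv; have [ARn _] := ARd n; apply: (ARn k sk v).1.
(* Indices are shifted by one: [d n] is $d_{n+1}$, and [M n] is the precision still available for
   its perturbation. *)
pose M n := (N - \sum_(i < n) s i)%N.
have N0M n : (n <= p)%N -> (N0 < M n)%N.
  move=> np; rewrite ltn_subRL; apply: leq_trans N0N.
  rewrite ltnS addnC leq_add2l -!(big_mkord xpredT s) (big_cat_nat _ np) //=.
  exact: leq_addr.
have sM n : (n <= p)%N -> (s n < M n)%N.
  by move=> np; apply: ltn_trans (sN0 n np) (N0M n np).
pose good n (E : 'M[R]_(b n.+1, b n)) :=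
  (forall i, mpowF m (M n) (b n) (row i E)) /\
  same_initial m (mx_im (d n)) (mx_im (d n + E)).
pose L' (v : 'rV[R]_(b 0%N)) := forall j, J (v 0 j).
have [E0 [E0good E0im]] : exists E0, good 0%N E0 /\ seteq (mx_im (d 0%N + E0)) L'.
  have L's : is_submod L'.
    case: Jid => J0 JD JM; split=> [j|v w Jv Jw j|x v Jv j]; rewrite mxE //.
      exact: JD.
    exact: JM.
  have dL' v : mx_im (d 0%N) v -> exists2 w, L' w & mpowF m (M 0%N) (b 0%N) (v - w).
    move=> /dI Iv; have /fin_all_exists2[w Jw vw] j :
        exists2 y, J y & ideal_pow m N (v 0 j - y).
      have /JI [y [z [Jy mz vE]]] : ideal_add I (ideal_pow m N) (v 0 j).
        by exists (v 0 j), 0; rewrite addr0; split=> //; case: (ideal_pow_ideal N mid).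
      by exists y => //; rewrite vE addrAC subrr add0r.
    exists (\row_j w j) => [j|]; first by rewrite mxE.
    by apply/(mpowFE _ _ mid) => j; rewrite /M big_ord0 subn0 !mxE.
  have dsub := sub_initial_perturb mloc L's (ard 0%N) (sM 0%N (leq0n p)) dL'.
  have subIJ k x : I x -> ideal_pow m k x -> exists2 y, J y & ideal_pow m k.+1 (x - y).
    (* The equality $b_0=1$ is only propositional, so $x$ is represented by a constant row and read
       back at a transported index. *)
    move=> Ix mx; have [||w [L'w _ /(mpowFE _ _ mid) mxw]] := dsub k (const_mx x).
    - by apply/dI => j; rewrite mxE.
    - by apply/(mpowFE _ _ mid) => j; rewrite mxE.
    pose j := cast_ord (esym b0) ord0; exists (w 0 j); first exact: L'w.
    by have := mxw j; rewrite !mxE.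
  have subJI := hilbert_sub_initial mloc noethR Iid Jid hilb subIJ.
  have L'd : sub_initial m L' (mx_im (d 0%N)).
    move=> k v Jv /(mpowFE _ _ mid) mv.
    have /fin_all_exists2[w Iw mw] j := subJI k (v 0 j) (Jv j) (mv j).
    exists (\row_j w j); split; first by apply/dI => j; rewrite mxE.
      apply/(mpowFE _ _ mid) => j; rewrite mxE.
      have -> : w j = v 0 j - (v 0 j - w j) by rewrite opprB addrCA subrr addr0.
      apply: (idealB (ideal_pow_ideal k mid)) => //.
      exact: ideal_pow_le mid (leqnSn k) (mw j).
    by apply/(mpowFE _ _ mid) => j; rewrite !mxE.
  have [E [mE EL']] := lift_generators mloc noethR L's L'd (ard 0%N) (sM 0%N (leq0n p)) dL'.
  exists E; split=> //; split=> //; apply/same_initialP => //; split.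
    by apply: sub_initial_trans dsub _ => //; apply: sub_initial_le => // v /EL'.
  by apply: sub_initial_trans _ L'd => //; apply: sub_initial_le => // v /EL'.
(* The hypotheses stand under the existential, with $0$ as default value, so that a successor exists
   for every [E] and the choice can be iterated. *)
have step n (E : 'M[R]_(b n.+1, b n)) : exists E' : 'M[R]_(b n.+2, b n.+1),
    (n < p)%N -> good n E ->
    good n.+1 E' /\ seteq (mx_ker (d n + E)) (mx_im (d n.+1 + E')).
  have [[np [mE /(same_initialP mloc)[dE Ed]]]|nP] := classic ((n < p)%N /\ good n E);
    last by exists 0 => np nE; case: nP.
  have ME : M n.+1 = (M n - s n)%N by rewrite /M big_ord_recr /= subnDA.
  have nM := sM n (ltnW np); set K' := mx_ker (d n + E).
  have arE := ar_bound_transfer mloc noethR (mx_im_submod _) dE Ed (ard n).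
  have dK' v : mx_im (d n.+1) v -> exists2 w, K' w & mpowF m (M n.+1) (b n.+1) (v - w).
    (* At $k=0$ the kernel elements are approximated to precision [M n - s n], which is exactly
       [M n.+1]. *)
    move=> /dex vd; rewrite ME; have [|w K'w mw] := ker_perturb mloc arE nM mE (k := 0) _ vd.
      by apply/(mpowFE _ _ mid).
    by exists w.
  have K's : is_submod K' := mx_ker_submod _.
  have dsub := sub_initial_perturb mloc K's (ard n.+1) (sM n.+1 np) dK'.
  have K'd : sub_initial m K' (mx_im (d n.+1)).
    apply: (@sub_initial_trans _ m mloc _ _ (mx_ker (d n))).
      (* The symmetric inclusion: [d n] is itself the perturbation of [d n + E] by [- E]. *)
      have -> : mx_ker (d n) = mx_ker (d n + E - E) by rewrite addrK.
      apply: (ker_sub_initial mloc _ nM) => [|i]; first by rewrite addrK; apply: ard.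
      by rewrite linearN -scaleN1r; case: (mpowF_submod (b n) (M n) mid) => _ _; apply; apply: mE.
    by apply: sub_initial_le => // v /dex.
  have [E' [mE' E'K']] := lift_generators mloc noethR K's K'd (ard n.+1) (sM n.+1 np) dK'.
  exists E' => _ _; split; last by move=> v; split=> /E'K'.
  split=> //; apply/same_initialP => //; split.
    by apply: sub_initial_trans dsub _ => //; apply: sub_initial_le => // v /E'K'.
  by apply: sub_initial_trans _ K'd => //; apply: sub_initial_le => // v /E'K'.
pose next n E := constructive_indefinite_description _ (step n E).
(* Each perturbation depends on the previous one, so the family is built by dependent recursion on
   chosen successors. *)
pose e := nat_rect (fun n => 'M[R]_(b n.+1, b n)) E0 (fun n E => sval (next n E)).
have egood n : (n <= p)%N -> good n (e n).
  elim: n => [//|n IHn] np; exact: (svalP (next n (e n)) np (IHn (ltnW np))).1.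
exists e; split=> [n np v|//|n np|n np].
- have [me _] := egood n np; apply: (mpowF_le mid (ltnW (N0M n np))).
  rewrite -[M n]add0n; apply: mpowF_mulmx => //; exact/(mpowFE _ _ mid).
- exact: (svalP (next n (e n)) np (egood n (ltnW np))).2.
- by case: (egood n np).
Qed.
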